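(* Let $(g,h,\omega)$ be a Born structure on a smooth manifold $M$ of dimension $2n$. Then the signature of $h$ is of the form $(2p,2q)$, where $p+q=n$.
   Context: A Born structure on a smooth manifold $M$ is a triple $(g,h,\omega)$ where $g,h$ are pseudo-Riemannian metrics (of any signature) and $\omega$ is a non-degenerate 2-form such that the endomorphism fields $A,B,J$ of $TM$ (the recursion operators) determined by $g(AX,Y)=\omega(X,Y)$, $g(BX,Y)=h(X,Y)$, $\omega(-JX,Y)=h(X,Y)$ satisfy $A^2=B^2=-J^2=\mathrm{Id}$. *)

(* Defs.v *)
From HB Require Import structures.
From mathcomp Require Import all_boot all_order all_algebra.
From mathcomp Require Import all_classical all_reals all_analysis.

Set Implicit Arguments.
Unset Strict Implicit.
Unset Printing Implicit Defensive.

Import Order.TTheory GRing.Theory Num.Theory.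
Import numFieldNormedType.Exports.

Local Open Scope classical_set_scope.
Local Open Scope ring_scope.

Section Smooth.
Context {R : realType} {V W : normedModType R}.

(* In finite dimension, the derivative of f is C^k iff all the directional
   derivatives 'D_v f are, so this is the usual notion of C^k function. *)
Fixpoint Ck_on (k : nat) (U : set V) (f : V -> W) : Prop :=
  match k with
  | 0 => forall x, U x -> {for x, continuous f}
  | k'.+1 => (forall x, U x -> differentiable f x) /\
             (forall v, Ck_on k' U ('D_v f))
  end.

Definition smooth_on (U : set V) (f : V -> W) : Prop :=
  forall k, Ck_on k U f.

End Smooth.

(* Only the values of chart_map on chart_dom and of chart_inv on its image
   matter. *)
Record chart (R : realType) (m : nat) (M : topologicalType) := Chart {
  chart_dom : set M;
  chart_map :> M -> 'rV[R]_m;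
  chart_inv : 'rV[R]_m -> M;
  chart_dom_open : open chart_dom;
  chart_cod_open : open (chart_map @` chart_dom);
  chart_mapK : {in chart_dom, cancel chart_map chart_inv};
  chart_map_continuous : forall x, chart_dom x -> {for x, continuous chart_map};
  chart_inv_continuous :
    forall y, (chart_map @` chart_dom) y -> {for y, continuous chart_inv}
}.

Definition chart_cod (R : realType) (m : nat) (M : topologicalType)
  (e : chart R m M) : set 'rV[R]_m := e @` chart_dom e.

Definition transition (R : realType) (m : nat) (M : topologicalType)
  (e f : chart R m M) : 'rV[R]_m -> 'rV[R]_m := f \o chart_inv e.

Record smooth_manifold (R : realType) (m : nat) := SmoothManifold {
  manifold_space :> topologicalType;
  manifold_hausdorff : hausdorff_space manifold_space;
  manifold_second_countable : @second_countable manifold_space;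
  atlas : set (chart R m manifold_space);
  atlas_cover : forall x, exists2 e, atlas e & chart_dom e x;
  atlas_compatible : forall e f, atlas e -> atlas f ->
    smooth_on (e @` (chart_dom e `&` chart_dom f)) (transition e f)
}.

Section TangentSpace.
Context {R : realType} {m : nat} {M : smooth_manifold R m}.

Definition chart_at (x : M) (e : chart R m M) : Prop :=
  atlas e /\ chart_dom e x.

(* A tangent vector at x is the family of its components in the charts at x,
   which transform by the Jacobian matrices of the coordinate changes; the value
   at a chart which is not a chart at x is the junk value 0. *)
Definition is_tangent (x : M) : {pred chart R m M -> 'rV[R]_m} :=
  [pred v | `[< (forall e, ~ chart_at x e -> v e = 0) /\
                (forall e f, chart_at x e -> chart_at x f ->
                   v f = v e *m 'J (transition e f) (e x)) >]].

Fact is_tangent_submod_closed (x : M) : submod_closed (is_tangent x).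
Proof.
split=> [|a u v].
  by apply/asboolP; split=> [//|e f _ _]; rewrite mul0mx.
move=> /asboolP[u0 uJ] /asboolP[v0 vJ]; apply/asboolP.
split=> [e xe|e f xe xf].
  by rewrite !fctE u0// v0// scaler0 addr0.
by rewrite !fctE (uJ e f)// (vJ e f)// mulmxDl scalemxAl.
Qed.

HB.instance Definition _ (x : M) :=
  GRing.isSubmodClosed.Build R (chart R m M -> 'rV[R]_m) (is_tangent x)
    (is_tangent_submod_closed x).

Record tangent (x : M) := Tangent {
  components :> chart R m M -> 'rV[R]_m;
  _ : components \in is_tangent x
}.

HB.instance Definition _ (x : M) := [isSub for @components x].
HB.instance Definition _ (x : M) := [Choice of tangent x by <:].
HB.instance Definition _ (x : M) :=
  [SubChoice_isSubLmodule of tangent x by <:].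

End TangentSpace.

Section TensorFields.
Context {R : realType} {m : nat} (M : smooth_manifold R m).

Definition bilinear_field := forall x : M, {biscalar (tangent x)}.

Definition endomorphism_field :=
  forall x : M, {linear (tangent x) -> (tangent x)}.

Implicit Types b c g h w : bilinear_field.

(* G is the matrix of components of b in the coordinates given by e. *)
Definition smooth_field b : Prop :=
  forall e, atlas e -> exists G : 'rV[R]_m -> 'M[R]_m,
    smooth_on (chart_cod e) G /\
    forall (x : M), chart_dom e x -> forall u v : tangent x,
      b x u v = (u e *m G (e x) *m (v e)^T) 0 0.

Definition nondegenerate_field b : Prop :=
  forall (x : M) (u : tangent x), (forall v, b x u v = 0) -> u = 0.

Definition pseudo_riemannian_metric g : Prop :=
  [/\ smooth_field g,
      forall (x : M) (u v : tangent x), g x u v = g x v u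
    & nondegenerate_field g].

Definition two_form w : Prop :=
  smooth_field w /\ forall (x : M) (u : tangent x), w x u u = 0.

(* The recursion operators A, B, J are uniquely determined by the first three
   equations, the forms g and w being nondegenerate. *)
Definition born_structure g h w : Prop :=
  [/\ pseudo_riemannian_metric g, pseudo_riemannian_metric h,
      two_form w, nondegenerate_field w
    & exists A B J : endomorphism_field,
      [/\ forall (x : M) (u v : tangent x), g x (A x u) v = w x u v,
          forall (x : M) (u v : tangent x), g x (B x u) v = h x u v,
          forall (x : M) (u v : tangent x), w x (- J x u) v = h x u v
        & forall (x : M) (u : tangent x),
            [/\ A x (A x u) = u, B x (B x u) = u & - J x (J x u) = u]]].

End TensorFields.

Definition is_basis (R : realType) (V : lmodType R) (k : nat) (E : 'I_k -> V) :
    Prop :=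
  forall v : V, exists! a : 'rV[R]_k, v = \sum_(i < k) a 0 i *: E i.

(* r is the number of positive squares, s the number of negative squares. *)
Definition has_signature (R : realType) (V : lmodType R) (b : V -> V -> R)
    (r s : nat) : Prop :=
  exists2 E : 'I_(r + s) -> V, is_basis E &
    forall i j, b (E i) (E j) =
      if i == j then (if (i < r)%N then 1 else -1) else 0.

(* Main.v *)
From HB Require Import structures.
Require Import Defs.
From mathcomp Require Import all_boot all_order all_algebra.
From mathcomp Require Import all_classical all_reals all_analysis.
From mathcomp Require Import lra zify.

Set Implicit Arguments.
Unset Strict Implicit.
Unset Printing Implicit Defensive.

Import Order.TTheory GRing.Theory Num.Theory.
Import numFieldNormedType.Exports.

Local Open Scope classical_set_scope.
Local Open Scope ring_scope.

(** The recursion operator [J] is a complex structure on each tangent space, and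
    it preserves [h]: from [h (u, v) = w (- J u, v)] and [J^2 = - 1] one gets
    [h (J u, J v) = w (u, J v) = - w (J v, u) = h (v, u) = h (u, v)]. Moreover
    [h (J u, u)] vanishes, being equal to its opposite. Hence a vector [y] with
    [h (y, y) = 1] or [- 1] spans with [J y] a [J]-stable plane on which [h] is
    definite, and [h] is nondegenerate on the orthogonal of this plane, which is
    again [J]-stable. Splitting off such planes one after the other produces an
    orthonormal basis with an even number of vectors of each sign
    ([complex_frame_exists]).

    The signature is the same at all the points of a connected component because
    it is locally constant, and a locally constant function is constant on
    connected sets. In a chart, [h] is a continuous field of matrices, and the
    vectors which span a positive (negative) definite subspace at a point span a
    positive (negative) definite subspace at nearby points. Since a positive
    definite subspace meets a negative definite one only at 0, neither
    the positive nor the negative index can drop near the point; as their sum is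
    the dimension, both are locally constant ([signature_locally_constant]).

    The link between the tangent spaces and matrices is that a chart at [x]
    identifies the tangent vectors at [x] with row vectors
    ([component_bijective]); that every row vector occurs is the chain rule for
    the coordinate changes. *)

(** * Orthonormal frames of a symmetric matrix *)

Section LinearAlgebra.
Context {F : rcfType} {m : nat}.
Implicit Types H J : 'M[F]_m.

(** The rows of [P] are the positive vectors and those of [N] the negative ones.
    Keeping them in two blocks makes the exchange of [H] and [- H] a mere
    exchange of [P] and [N]. *)
Definition orthonormal_frame H a b (P : 'M[F]_(a, m)) (N : 'M[F]_(b, m)) :=
  [/\ P *m H *m P^T = 1%:M, N *m H *m N^T = - 1%:M & P *m H *m N^T = 0].

Lemma row_gramE (H : 'M[F]_m) a b (P : 'M[F]_(a, m)) (N : 'M[F]_(b, m)) i j :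
  (row i P *m H *m (row j N)^T) 0 0 = (P *m H *m N^T) i j.
Proof.
by rewrite -row_mul tr_row !mxE; apply: eq_bigr => k _; rewrite !mxE.
Qed.

Lemma gram_inj (A B : 'M[F]_m) :
  (forall x y : 'rV_m, (x *m A *m y^T) 0 0 = (x *m B *m y^T) 0 0) -> A = B.
Proof.
move=> AB; apply/matrixP => i j.
have := AB (row i 1%:M) (row j 1%:M).
by rewrite !row_gramE !trmx1 !mulmx1 !mul1mx.
Qed.

Lemma mulmx_tr_ge0 k (x : 'rV[F]_k) : 0 <= (x *m x^T) 0 0.
Proof. by rewrite mxE sumr_ge0// => i _; rewrite mxE -expr2 sqr_ge0. Qed.

Lemma mulmx_tr_eq0 k (x : 'rV[F]_k) : (x *m x^T) 0 0 = 0 -> x = 0.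
Proof.
rewrite mxE => /eqP; rewrite psumr_eq0; last first.
  by move=> i _; rewrite mxE -expr2 sqr_ge0.
move=> /allP x0; apply/rowP => i; apply/eqP; rewrite mxE.
by have := x0 i (mem_index_enum i); rewrite mxE -expr2 sqrf_eq0.
Qed.

Lemma row_free_le k (A : 'M[F]_(k, m)) : row_free A -> (k <= m)%N.
Proof. by move=> /eqP <-; exact: rank_leq_col. Qed.

(** The two row spaces meet only at 0, because the form is positive on the first
    and negative on the second; this is the dimension count of Sylvester's law of
    inertia. *)
Lemma definite_row_free H a b (P : 'M[F]_(a, m)) (N : 'M[F]_(b, m)) :
  (forall x : 'rV_a, x != 0 -> 0 < (x *m (P *m H *m P^T) *m x^T) 0 0) ->
  N *m H *m N^T = - 1%:M -> row_free (col_mx P N).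
Proof.
move=> Ppos NN.
rewrite -kermx_eq0; apply/eqP/row_matrixP => i.
rewrite row0; set z := row i _.
(* A relation [x P + y N = 0] is a vector common to the two subspaces. *)
have : z *m col_mx P N = 0 by apply/eqP; rewrite -sub_kermx row_sub.
rewrite -[z]hsubmxK mul_row_col; set x := lsubmx z; set y := rsubmx z.
move=> /eqP; rewrite addr_eq0 => /eqP xPyN.
have xy : x *m (P *m H *m P^T) *m x^T = - (y *m y^T).
  transitivity (x *m P *m H *m (x *m P)^T); first by rewrite trmx_mul !mulmxA.
  rewrite xPyN linearN/= mulNmx mulmxN mulNmx opprK trmx_mul !mulmxA.
  by rewrite -!mulmxA (mulmxA H) (mulmxA N) (mulmxA N) NN mulNmx mul1mx mulmxN.
have x0 : x = 0.
  apply/eqP/negPn/negP => /Ppos; rewrite xy mxE oppr_gt0.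
  by rewrite ltNge mulmx_tr_ge0.
have y0 : y = 0.
  apply: mulmx_tr_eq0; move: xy; rewrite x0 mul0mx mul0mx => /esym/eqP.
  by rewrite oppr_eq0 => /eqP ->; rewrite mxE.
by rewrite x0 y0 row_mx0.
Qed.

Lemma orthonormal_frame_row_free H a b (P : 'M[F]_(a, m)) (N : 'M[F]_(b, m)) :
  orthonormal_frame H P N -> row_free (col_mx P N).
Proof.
move=> [PP NN _]; apply: (@definite_row_free H) => // x x0.
rewrite PP mulmx1 lt_neqAle mulmx_tr_ge0 andbT eq_sym.
by apply: contra_neq x0; exact: mulmx_tr_eq0.
Qed.

Lemma orthonormal_frameN H a b (P : 'M[F]_(a, m)) (N : 'M[F]_(b, m)) :
  H^T = H -> orthonormal_frame (- H) N P -> orthonormal_frame H P N.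
Proof.
move=> Hs [NN PP NP]; split.
- by move: PP; rewrite mulmxN mulNmx => /oppr_inj.
- by rewrite -NN mulmxN mulNmx opprK.
- apply: trmx_inj; move: NP; rewrite mulmxN mulNmx => /eqP.
  by rewrite oppr_eq0 trmx0 !trmx_mul trmxK Hs mulmxA => /eqP.
Qed.

Lemma quadratic_eq0 (K : 'M[F]_m) : K^T = K ->
  (forall x : 'rV_m, (x *m K *m x^T) 0 0 = 0) -> K = 0.
Proof.
move=> Ks K0.
have sym (x y : 'rV_m) : (x *m K *m y^T) 0 0 = (y *m K *m x^T) 0 0.
  have <- : (y *m K *m x^T)^T = x *m K *m y^T.
    by rewrite !trmx_mul trmxK Ks mulmxA.
  by rewrite mxE.
apply: gram_inj => x y; rewrite mulmx0 mul0mx [RHS]mxE.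
have := K0 (x + y).
rewrite mulmxDl linearD/= mulmxDr !mulmxDl !mxE.
have := K0 x; have := K0 y; have := sym x y; rewrite !mxE => -> -> ->.
rewrite add0r addr0 => /eqP.
by rewrite -mulr2n mulrn_eq0 => /eqP.
Qed.

(** The orthogonal of the frame is the row space of the matrix [Q] of the
    projection [v |-> v - (sum of the +- h(v, e) e over the frame)]. It is
    nonzero for lack of rank, and the form cannot vanish identically on it since
    [H] is invertible. *)
Lemma exists_orthogonal_unit H a b (P : 'M[F]_(a, m)) (N : 'M[F]_(b, m)) :
  H^T = H -> H \in unitmx -> orthonormal_frame H P N -> (a + b < m)%N ->
  exists2 y : 'rV[F]_m, y *m H *m P^T = 0 /\ y *m H *m N^T = 0 &
    y *m H *m y^T = 1%:M \/ y *m H *m y^T = - 1%:M.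
Proof.
move=> Hs Hu [PP NN PN] abm.
have NP : N *m H *m P^T = 0.
  by apply: trmx_inj; rewrite trmx0 -PN !trmx_mul trmxK Hs mulmxA.
pose Q := 1%:M - H *m P^T *m P + H *m N^T *m N.
have QP : Q *m H *m P^T = 0.
  rewrite /Q !mulmxDl !mulNmx mul1mx -!mulmxA (mulmxA P) PP (mulmxA N) NP.
  by rewrite !mulmx0 mulmx1 addr0 subrr.
have QN : Q *m H *m N^T = 0.
  rewrite /Q !mulmxDl !mulNmx mul1mx -!mulmxA (mulmxA P) PN (mulmxA N) NN.
  by rewrite !mulmx0 !mulmxN mulmx1 subr0 subrr.
have Q0 : Q != 0.
  apply: contraTneq abm => Q0; rewrite -leqNgt.
  (* Otherwise the identity factors through a space of dimension [a + b]. *)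
  have E1 : row_mx (H *m P^T) (- (H *m N^T)) *m col_mx P N = 1%:M.
    rewrite mul_row_col mulNmx; apply/esym/eqP.
    by rewrite -subr_eq0 opprB addrA addrAC -[X in X == 0]/Q Q0.
  rewrite -(mxrank1 F m) -E1.
  by rewrite (leq_trans (mxrankM_maxl _ _))// rank_leq_col.
have QHQ : Q *m H *m Q^T = Q *m H.
  have -> : Q^T = 1%:M - P^T *m (P *m H) + N^T *m (N *m H).
    by rewrite !raddfD raddfN /= trmx1 !trmx_mul !trmxK Hs.
  by rewrite !mulmxDr mulmxN mulmx1 !mulmxA QP QN !mul0mx subr0 addr0.
have [x xQ0] : exists x : 'rV_m, (x *m (Q *m H *m Q^T) *m x^T) 0 0 != 0.
  apply: contrapT => /forallNP QH0.
  have : Q *m H *m Q^T = 0.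
    apply: quadratic_eq0; first by rewrite !trmx_mul trmxK Hs mulmxA.
    by move=> x; apply/eqP/negPn/negP; exact: QH0.
  rewrite QHQ => /(congr1 (mulmx^~ (invmx H))).
  by rewrite mulmxK// mul0mx => /eqP; rewrite (negbTE Q0).
set c := (X in X != 0) in xQ0.
pose s := (Num.sqrt `|c|)^-1.
have s2 : s ^+ 2 = `|c|^-1 by rewrite exprVn sqr_sqrtr.
have sE : (s *: (x *m Q)) *m H *m (s *: (x *m Q))^T = (c / `|c|)%:M.
  rewrite linearZ/= -!scalemxAl -scalemxAr scalerA -expr2 s2 trmx_mul !mulmxA.
  rewrite [X in _ *: X]mx11_scalar scale_scalar_mx mulrC; congr (_ / _)%:M.
  by rewrite /c !mulmxA.
exists (s *: (x *m Q)).
  by split; rewrite -!scalemxAl -!mulmxA (mulmxA Q) ?QP ?QN mulmx0 scaler0.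
rewrite sE; case: (ltgtP c 0) xQ0 => // c0 _.
- by right; rewrite ltr0_norm// invrN mulrN divff ?lt_eqF// raddfN.
- by left; rewrite gtr0_norm// divff ?gt_eqF.
Qed.

(** Since [J] is an isometry with [J^2 = - 1], it is skew for the form. So
    [J y] has the same norm as [y], is orthogonal to [y], and is orthogonal to
    every [J]-stable subspace which is orthogonal to [y]. *)
Lemma orthonormal_frame_extend H J a b (P : 'M[F]_(a, m)) (N : 'M[F]_(b, m))
    (y : 'rV[F]_m) :
  H^T = H -> J *m J = - 1%:M -> J *m H *m J^T = H ->
  orthonormal_frame H P N -> stablemx P J -> stablemx N J ->
  y *m H *m P^T = 0 -> y *m H *m N^T = 0 -> y *m H *m y^T = 1%:M ->
  exists2 P' : 'M[F]_(1 + 1 + a, m), orthonormal_frame H P' N &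
    stablemx P' J.
Proof.
move=> Hs JJ JH [PP NN PN] PJ NJ yP yN yy.
(* [J] is skew-adjoint for the form. *)
have JHE : J *m H = - (H *m J^T).
  by rewrite -{2}JH -!mulmxA -trmx_mul JJ linearN/= trmx1 !mulmxN mulmx1 opprK.
have yJ b' (A : 'M[F]_(b', m)) : stablemx A J -> y *m H *m A^T = 0 ->
    y *m J *m H *m A^T = 0.
  move=> /submxP[D AJ] yA.
  rewrite -!mulmxA (mulmxA J) JHE mulNmx mulmxN -mulmxA -trmx_mul AJ trmx_mul.
  by rewrite !mulmxA yA mul0mx oppr0.
have yJP := yJ _ _ PJ yP; have yJN := yJ _ _ NJ yN.
have Py : P *m H *m y^T = 0.
  by apply: trmx_inj; rewrite trmx0 -yP !trmx_mul trmxK Hs mulmxA.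
have PyJ : P *m H *m (y *m J)^T = 0.
  by apply: trmx_inj; rewrite trmx0 -yJP !trmx_mul !trmxK Hs !mulmxA.
have yJyJ : y *m J *m H *m (y *m J)^T = 1%:M.
  by rewrite trmx_mul -yy -[in RHS]JH !mulmxA.
have yJy : y *m J *m H *m y^T = 0.
  (* A scalar equal to its opposite. *)
  have yJyE : y *m J *m H *m y^T = - (y *m J *m H *m y^T)^T.
    rewrite !trmx_mul trmxK Hs -mulmxA -(mulmxA y) (mulmxA J) JHE.
    by rewrite mulNmx mulmxN !mulmxA.
  move: yJyE; set c := y *m J *m H *m y^T.
  have -> : c^T = c by rewrite [c]mx11_scalar tr_scalar_mx.
  move/eqP; rewrite -addr_eq0 -mulr2n => /eqP/matrixP E.
  apply/matrixP => i j; have /eqP := E i j.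
  by rewrite !mxE -mulr2n mulrn_eq0 => /eqP.
have yyJ : y *m H *m (y *m J)^T = 0.
  by apply: trmx_inj; rewrite trmx0 -yJy !trmx_mul !trmxK Hs !mulmxA.
exists (col_mx (col_mx y (y *m J)) P).
  split=> //.
  - rewrite !tr_col_mx !mul_col_mx !mul_mx_row yy yyJ yJy yJyJ PP Py PyJ yP yJP.
    rewrite row_mx0 -block_mxEv block_mxEh col_mx0 -!block_mxEv.
    by rewrite -!scalar_mx_block.
  - by rewrite !mul_col_mx yN yJN PN !col_mx0.
rewrite mul_col_mx col_mx_sub; apply/andP; split; last first.
  apply: (submx_trans PJ); rewrite -addsmxE; exact: addsmxSr.
apply: (submx_trans (B := col_mx y (y *m J))); last first.
  by apply: submx_trans (addsmxSl _ P) _; rewrite addsmxE.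
rewrite mul_col_mx col_mx_sub -mulmxA JJ mulmxN mulmx1 eqmx_opp.
by rewrite -!addsmxE addsmxSl addsmxSr.
Qed.

(** The [J]-stable frame grows by two vectors of the same sign at a time, so
    both its parts keep an even size until it is a basis. *)
Lemma complex_frame_exists H J :
  H^T = H -> H \in unitmx -> J *m J = - 1%:M -> J *m H *m J^T = H ->
  exists p q (P : 'M[F]_(2 * p, m)) (N : 'M[F]_(2 * q, m)),
    orthonormal_frame H P N /\ (2 * p + 2 * q = m)%N.
Proof.
move=> Hs Hu JJ JH.
(* The sizes are variables tied to [2 * p] and [2 * q] by equations, since the
   frame produced by [orthonormal_frame_extend] has size [1 + 1 + a]. *)
suff extend k : forall p q a b (P : 'M[F]_(a, m)) (N : 'M[F]_(b, m)),
    a = (2 * p)%N -> b = (2 * q)%N ->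
    orthonormal_frame H P N -> stablemx P J -> stablemx N J ->
    (m - (a + b) <= k)%N ->
    exists p q (P : 'M[F]_(2 * p, m)) (N : 'M[F]_(2 * q, m)),
      orthonormal_frame H P N /\ (2 * p + 2 * q = m)%N.
  apply: (extend m 0%N 0%N 0%N 0%N 0 0); rewrite ?leq_subr ?mul0mx ?sub0mx//.
  by split; rewrite ?mul0mx//; apply/matrixP => -[].
elim: k => [|k IHk] p q a b P N a2 b2 PN PJ NJ mk;
    have abm : (a + b <= m)%N :=
      row_free_le (orthonormal_frame_row_free PN);
    have [mab|abm'] := leqP m (a + b); [|lia| |].
- by exists p, q; subst a b; exists P, N; split=> //; lia.
- by exists p, q; subst a b; exists P, N; split=> //; lia.
have [y [yP yN] [yy|yy]] := exists_orthogonal_unit Hs Hu PN abm'.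
- have [P' P'N P'J] := orthonormal_frame_extend Hs JJ JH PN PJ NJ yP yN yy.
  by apply: (IHk p.+1 q _ _ _ _ _ b2 P'N P'J NJ); lia.
(* A negative vector is a positive vector of the form [- H]. *)
- have Hs' : (- H)^T = - H by rewrite raddfN/= Hs.
  have JH' : J *m - H *m J^T = - H by rewrite mulmxN mulNmx JH.
  have NP : orthonormal_frame (- H) N P.
    by apply: orthonormal_frameN => //; rewrite opprK.
  have yN' : y *m - H *m N^T = 0 by rewrite mulmxN mulNmx yN oppr0.
  have yP' : y *m - H *m P^T = 0 by rewrite mulmxN mulNmx yP oppr0.
  have yy' : y *m - H *m y^T = 1%:M by rewrite mulmxN mulNmx yy opprK.
  have [N' N'P N'J] :=
    orthonormal_frame_extend Hs' JJ JH' NP NJ PJ yN' yP' yy'.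
  have {}N'P := orthonormal_frameN Hs N'P.
  by apply: (IHk p q.+1 _ _ _ _ a2 _ N'P PJ N'J); lia.
Qed.

End LinearAlgebra.

(** * Persistence of the signature under perturbation *)

Section LocalConstancy.
Context {R : realType} {m : nat}.
Implicit Types H : 'M[R]_m.

(** Follows from [|y_i y_j| <= (y_i^2 + y_j^2) / 2]. *)
Lemma quadratic_le k (E : 'M[R]_k) (y : 'rV[R]_k) (e : R) :
  (forall i j, `|E i j| <= e) ->
  `|(y *m E *m y^T) 0 0| <= e * k%:R * (y *m y^T) 0 0.
Proof.
move=> Ee; rewrite !mxE.
have yE i j : `|y 0 i * E i j * y 0 j| <= e / 2 * (y 0 i ^+ 2 + y 0 j ^+ 2).
  rewrite !normrM -(real_normK (num_real (y 0 i))).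
  rewrite -(real_normK (num_real (y 0 j))).
  have := Ee i j; have := normr_ge0 (y 0 i); have := normr_ge0 (y 0 j).
  have := normr_ge0 (E i j).
  move: `|y 0 i| `|y 0 j| `|E i j| => a b c c0 b0 a0 ce.
  have := mulr_ge0 a0 b0; have := sqr_ge0 (a - b); nra.
apply: (@le_trans _ _ (\sum_j \sum_i e / 2 * (y 0 i ^+ 2 + y 0 j ^+ 2))).
  apply: (le_trans (ler_norm_sum _ _ _)); apply: ler_sum => j _.
  rewrite !mxE mulr_suml; apply: (le_trans (ler_norm_sum _ _ _)).
  by apply: ler_sum => i _; exact: yE.
have -> : \sum_i y 0 i * y^T i 0 = \sum_i y 0 i ^+ 2.
  by apply: eq_bigr => i _; rewrite mxE.
set S := \sum_i y 0 i ^+ 2.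
under eq_bigr => j _ do rewrite -mulr_sumr big_split/= sumr_const card_ord.
rewrite -mulr_sumr big_split/= sumr_const card_ord sumrMnl -/S.
by rewrite -mulr_natr; lra.
Qed.

(** Positivity on a fixed subspace is an open condition: by [quadratic_le],
    moving [H0] to [H] changes the form at [x P] by at most a constant times
    [|H0 - H| x x^T], where [x x^T] is the value of the form before the change. *)
Lemma positive_frame_open H0 a (P : 'M[R]_(a, m)) :
  P *m H0 *m P^T = 1%:M ->
  exists2 e : R, 0 < e & forall H, `|H0 - H| < e ->
    forall x : 'rV_a, x != 0 -> 0 < (x *m (P *m H *m P^T) *m x^T) 0 0.
Proof.
move=> PP.
have entry_le k l (A : 'M[R]_(k, l)) i j : `|A i j| <= `|A|.
  rewrite [leRHS]/Num.Def.normr/= mx_normrE.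
  by apply/bigmax_geP; right => /=; exists (i, j).
(* [c] bounds the squared norm of [x P] by that of [x]. *)
pose c := `|P *m P^T| * a%:R; have c0 : 0 <= c by rewrite mulr_ge0.
have mc1 : 0 < m%:R * c + 1 by rewrite ltr_wpDl// mulr_ge0.
exists (m%:R * c + 1)^-1; first by rewrite invr_gt0.
move=> H HH x x0; set e := `|H0 - H| in HH.
have xx : 0 < (x *m x^T) 0 0.
  rewrite lt_neqAle mulmx_tr_ge0 andbT eq_sym.
  by apply: contra_neq x0; exact: mulmx_tr_eq0.
have xP : (x *m P *m (x *m P)^T) 0 0 <= c * (x *m x^T) 0 0.
  rewrite trmx_mul mulmxA -(mulmxA x P).
  by apply: (le_trans (ler_norm _)); apply: quadratic_le.
have := @quadratic_le _ (H0 - H) (x *m P) e (entry_le _ _ _).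
have -> : x *m P *m (H0 - H) *m (x *m P)^T =
    x *m x^T - x *m (P *m H *m P^T) *m x^T.
  rewrite mulmxBr mulmxBl trmx_mul; congr (_ - _); last by rewrite !mulmxA.
  transitivity (x *m (P *m H0 *m P^T) *m x^T); first by rewrite !mulmxA.
  by rewrite PP mulmx1.
rewrite [X in `|X|]mxE [X in `|_ + X|]mxE.
move=> /(le_trans (ler_norm _)).
have e0 : 0 <= e := normr_ge0 _.
have emc : e * (m%:R * c + 1) < 1 by rewrite -ltr_pdivlMr// mul1r.
have m0 : 0 <= m%:R :> R := ler0n _ _.
move: (m%:R : R) xP xx m0 emc => M.
move: ((x *m P *m (x *m P)^T) 0 0) ((x *m x^T) 0 0).
move: ((x *m _ *m x^T) 0 0) => w u v uv v0 M0 eM H1.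
have : e * M * u <= e * M * (c * v) by rewrite ler_wpM2l// mulr_ge0.
have : (e * (M * c + 1)) * v < v by rewrite gtr_pMl.
have : 0 <= e * v by rewrite mulr_ge0// ltW.
rewrite mulrDr mulr1 mulrDl !mulrA; lra.
Qed.

(** Near [H0] the rows of [P] still span a positive definite subspace, which
    bounds [a] by [m - b' = a']; symmetrically [b <= b']. *)
Lemma signature_locally_constant H0 a b (P : 'M[R]_(a, m)) (N : 'M[R]_(b, m)) :
  orthonormal_frame H0 P N -> (a + b = m)%N ->
  \forall H \near H0,
    forall a' b' (P' : 'M[R]_(a', m)) (N' : 'M[R]_(b', m)),
      orthonormal_frame H P' N' -> (a' + b' = m)%N -> a' = a.
Proof.
move=> [PP NN _] abm.
have [e e0 Ppos] := positive_frame_open PP.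
have [|d d0 Nneg] := @positive_frame_open (- H0) _ N.
  by rewrite mulmxN mulNmx NN opprK.
near=> H => a' b' P' N' [PP' NN' _] abm'.
have ab' : (a + b' <= m)%N.
  apply/row_free_le/(@definite_row_free _ _ H _ _ P N') => //; apply: Ppos.
  by near: H; apply: cvgr_dist_lt.
have ba' : (b + a' <= m)%N.
  apply/row_free_le/(@definite_row_free _ _ (- H) _ _ N P').
    apply: Nneg; rewrite -opprD normrN.
    by near: H; apply: cvgr_dist_lt.
  by rewrite mulmxN mulNmx PP'.
lia.
Unshelve. all: by end_near. Qed.

End LocalConstancy.

(** * Signature of a bilinear form in coordinates *)

Section Signature.
Context {R : realType} {m : nat}.
Context {V : lmodType R} (b : V -> V -> R).
Context {phi : {linear V -> 'rV[R]_m}} {psi : {linear 'rV[R]_m -> V}}.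
Hypotheses (phiK : cancel phi psi) (psiK : cancel psi phi).
Context {H : 'M[R]_m}.
Hypothesis bE : forall u v, b u v = (phi u *m H *m (phi v)^T) 0 0.

Lemma has_signature_frame r s : has_signature b r s ->
  exists (P : 'M[R]_(r, m)) (N : 'M[R]_(s, m)), orthonormal_frame H P N.
Proof.
move=> [E _ bEE].
exists (\matrix_i phi (E (lshift s i))), (\matrix_i phi (E (rshift r i))).
split; apply/matrixP => i j; rewrite -row_gramE !rowK -bE bEE.
- by rewrite eq_lshift /= ltn_ord mxE; case: eqP.
- by rewrite eq_rshift /= ltnNge leq_addr/= !mxE; case: eqP; rewrite ?oppr0.
- by rewrite eq_lrshift mxE.
Qed.

(** The frame is a basis because its vectors are independent and as many as the
    dimension. *)
Lemma frame_has_signature r s (P : 'M[R]_(r, m)) (N : 'M[R]_(s, m)) :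
  H^T = H -> orthonormal_frame H P N -> (r + s = m)%N -> has_signature b r s.
Proof.
move=> Hs PN rsm; have K_free := orthonormal_frame_row_free PN.
have [PP NN PN0] := PN.
have NP0 : N *m H *m P^T = 0.
  by apply: trmx_inj; rewrite trmx0 -PN0 !trmx_mul trmxK Hs mulmxA.
have K_full : row_full (col_mx P N) by rewrite /row_full (eqP K_free) rsm.
exists (fun i => psi (row i (col_mx P N))).
  move=> v; have combE (a : 'rV_(r + s)) :
      \sum_(i < r + s) a 0 i *: psi (row i (col_mx P N)) =
      psi (a *m col_mx P N).
    by rewrite mulmx_sum_row linear_sum; apply: eq_bigr => i _; rewrite linearZ.
  exists (phi v *m pinvmx (col_mx P N)); split=> [|a].
    by rewrite combE mulmxKpV ?submx_full// phiK.
  rewrite combE => ->; rewrite psiK; apply: (row_free_inj K_free).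
  by rewrite mulmxKpV ?submx_full.
move=> i j; rewrite bE !psiK.
case: (split_ordP i) => i' ->; case: (split_ordP j) => j' ->;
  rewrite ?rowKu ?rowKd row_gramE ?PP ?NN ?PN0 ?NP0 !mxE.
- by rewrite eq_lshift; case: eqP.
- by rewrite eq_lrshift.
- by rewrite eq_rlshift.
- by rewrite eq_rshift; case: eqP; rewrite ?oppr0.
Qed.

(** Transports [complex_frame_exists] through the coordinates [phi], in which the
    nondegenerate form [b] has an invertible matrix. *)
Lemma complex_isometry_signature (J : {linear V -> V}) :
  (forall u v, b u v = b v u) -> (forall u, (forall v, b u v = 0) -> u = 0) ->
  (forall u, J (J u) = - u) -> (forall u v, b (J u) (J v) = b u v) ->
  exists p q, (2 * p + 2 * q = m)%N /\ has_signature b (2 * p) (2 * q).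
Proof.
move=> bs b0 JJ Jb.
have bpsi x y : b (psi x) (psi y) = (x *m H *m y^T) 0 0 by rewrite bE !psiK.
have Hs : H^T = H.
  apply: gram_inj => x y; rewrite -[RHS]bpsi bs bpsi.
  have <- : (y *m H *m x^T)^T = x *m H^T *m y^T.
    by rewrite !trmx_mul trmxK mulmxA.
  by rewrite mxE.
have Hu : H \in unitmx.
  rewrite -row_free_unit -kermx_eq0; apply/eqP/row_matrixP => i; rewrite row0.
  apply: (can_inj psiK); rewrite linear0; apply: b0 => v.
  by rewrite bE psiK (sub_kermxP (row_sub _ _)) mul0mx mxE.
pose A := lin1_mx (phi \o J \o psi).
have AE x : x *m A = phi (J (psi x)) by rewrite mul_rV_lin1.
have AA : A *m A = - 1%:M.
  apply/row_matrixP => i; rewrite -[row i _]mulmx1 !rowE mulmx1 !mulmxA !AE phiK.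
  by rewrite JJ linearN psiK mulmxN mulmx1.
have AH : A *m H *m A^T = H.
  apply: gram_inj => x y; rewrite -[RHS]bpsi -Jb bE -!AE trmx_mul.
  by rewrite !mulmxA.
have [p [q [P [N [PN pqm]]]]] := complex_frame_exists Hs Hu AA AH.
by exists p, q; split=> //; exact: frame_has_signature PN pqm.
Qed.

End Signature.

(** * Coordinates on the tangent spaces *)

Section Coordinates.
Context {R : realType} {m : nat} {M : smooth_manifold R m}.
Implicit Types (x : M) (e f k : chart R m M).

Lemma transition_differentiable e f x : chart_at x e -> chart_at x f ->
  differentiable (transition e f) (e x).
Proof.
move=> [ae ex] [af fx]; have [+ _] := atlas_compatible ae af 1.
by apply; exists x.
Qed.

Lemma mulmx_jacobian e f x (v : 'rV[R]_m) : chart_at x e -> chart_at x f ->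
  v *m 'J (transition e f) (e x) = 'D_v (transition e f) (e x).
Proof.
by move=> xe xf; rewrite deriveEjacobian; last exact: transition_differentiable.
Qed.

(** The coordinate change [transition e f] is composed of [chart_inv e] and [f]
    with total functions, and is meaningful only at the points that this lemma
    describes; they fill a neighborhood of [e x]. *)
Lemma near_chart_inv e f x : chart_at x e -> chart_at x f ->
  \forall y \near e x, exists2 z, chart_dom e z /\ chart_dom f z & y = e z.
Proof.
move=> [_ ex] [_ fx].
have cod_ex : chart_cod e (e x) by exists x.
have cod_near : \forall y \near e x, chart_cod e y.
  by apply: open_nbhs_nbhs; split=> //; exact: chart_cod_open.
have dom_near : \forall y \near e x, chart_dom f (chart_inv e y).
  apply: (chart_inv_continuous cod_ex).
  rewrite chart_mapK ?inE//.
  by apply: open_nbhs_nbhs; split=> //; exact: chart_dom_open.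
near=> y.
have [z ez zy] : chart_cod e y by near: y.
exists z => //; split=> //.
have : chart_dom f (chart_inv e y) by near: y.
by rewrite -zy chart_mapK// inE.
Unshelve. all: by end_near. Qed.

Lemma jacobian_transition_id e x : chart_at x e ->
  'J (transition e e) (e x) = 1%:M.
Proof.
move=> xe; apply/row_matrixP => i; rewrite !rowE mulmx1.
rewrite -deriveEjacobian; last exact: transition_differentiable.
rewrite (near_eq_derive (g := id)); first by rewrite derive_id.
apply: filterS (near_chart_inv xe xe) => y [z [ez _] ->].
by rewrite /transition /= chart_mapK ?inE.
Qed.

(** The chain rule, as [transition e k] and [transition f k \o transition e f]
    agree near [e x]. It makes the transformation rule of tangent vectors
    consistent. *)
Lemma jacobian_transition_comp e f k x :
  chart_at x e -> chart_at x f -> chart_at x k ->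
  'J (transition e k) (e x) =
  'J (transition e f) (e x) *m 'J (transition f k) (f x).
Proof.
move=> xe xf xk.
have efx : transition e f (e x) = f x.
  by rewrite /transition /= chart_mapK// inE; case: xe.
have def := transition_differentiable xe xf.
have dfk := transition_differentiable xf xk.
apply/row_matrixP => i; rewrite !rowE mulmxA.
rewrite [LHS](mulmx_jacobian _ xe xk).
rewrite [X in _ = X *m _](mulmx_jacobian _ xe xf) [RHS](mulmx_jacobian _ xf xk).
rewrite (near_eq_derive (g := transition f k \o transition e f)).
  rewrite -efx in dfk *; rewrite deriveE; last exact: differentiable_comp.
  by rewrite diff_comp//= -!deriveE.
apply: filterS (near_chart_inv xe xf) => y [z [ez fz] ->].
by rewrite /transition /= !chart_mapK ?inE.
Qed.

(** Evaluation at a chart, under a name to which a linear structure can be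
    attached. *)
Definition component e x (u : tangent x) : 'rV[R]_m := u e.

Fact component_is_linear e x : linear (@component e x).
Proof. by []. Qed.

HB.instance Definition _ e x :=
  GRing.isLinear.Build R (tangent x) 'rV[R]_m _ (@component e x)
    (@component_is_linear e x).

(** The vector with component [r] in the chart [e] must have component
    [r *m 'J (transition e f) (e x)] in every other chart [f] at [x];
    [jacobian_transition_comp] says that this family is tangent. *)
Lemma component_bijective e x : chart_at x e ->
  exists psi : {linear 'rV[R]_m -> tangent x},
    cancel (@component e x) psi /\ cancel psi (@component e x).
Proof.
move=> xe.
pose v (r : 'rV[R]_m) f : 'rV[R]_m :=
  if `[< chart_at x f >] then r *m 'J (transition e f) (e x) else 0.
have vP r : v r \in is_tangent x.
  apply/asboolP; split=> [f xf|f k xf xk]; first by rewrite /v asboolF.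
  rewrite /v (asboolT xf) (asboolT xk) -mulmxA; congr (_ *m _).
  exact: jacobian_transition_comp.
pose psi r : tangent x := Tangent (vP r).
have psiK : cancel psi (@component e x).
  move=> r.
  by rewrite /component /= /v asboolT// jacobian_transition_id// mulmx1.
have phiK : cancel (@component e x) psi.
  move=> [u uP]; apply: val_inj; apply/funext => f; rewrite /= /v.
  move: uP => /asboolP[u0 uJ].
  by case: asboolP => [xf|/u0 ->//]; rewrite (uJ e f).
pose psi_linear := GRing.isLinear.Build _ _ _ _ psi (can2_linear phiK psiK).
pose psiL : {linear 'rV[R]_m -> tangent x} := HB.pack psi psi_linear.
by exists psiL.
Qed.

End Coordinates.

(** * Signature of the metric of a Born structure *)

Section Born.
Context {R : realType} {m : nat} {M : smooth_manifold R m}.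
Context {g h w : bilinear_field M}.
Hypothesis ghw : born_structure g h w.

(** Here [J] preserves [h] because [w] is alternating and [h] is symmetric. *)
Lemma born_signature (x : M) :
  exists p q, (2 * p + 2 * q = m)%N /\ has_signature (h x) (2 * p) (2 * q).
Proof.
have [_ [hsm hs hn] [_ walt] _ [A [B [J [_ _ wJ AJ]]]]] := ghw.
have [e ae ex] := atlas_cover x.
have [psi [phiK psiK]] := component_bijective (conj ae ex).
have [G [_ hG]] := hsm e ae.
have wa u v : w x u v = - w x v u.
  apply/eqP; rewrite -addr_eq0; have := walt x (u + v).
  by rewrite linearD/= !linearDl !walt addr0 add0r addrC => ->.
apply: (complex_isometry_signature phiK psiK (hG x ex) (J := J x)).
- exact: hs.
- exact: hn.
- by move=> u; have [_ _ JJ] := AJ x u; rewrite -{2}JJ opprK.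
- move=> u v; have [_ _ JJ] := AJ x u.
  by rewrite -wJ JJ wa -[in LHS](opprK (J x v)) linearNl/= opprK wJ hs.
Qed.

(** A single chart around [x] serves all nearby points, and in it the matrix of
    [h] varies continuously. *)
Lemma near_signature (x : M) (r s : nat) :
  has_signature (h x) r s -> (r + s = m)%N ->
  \forall y \near x, forall r' s', has_signature (h y) r' s' ->
    (r' + s' = m)%N -> r' = r.
Proof.
have [_ [hsm _ _] _ _ _] := ghw.
have [e ae ex] := atlas_cover x.
have [G [Gsm hG]] := hsm e ae.
move=> /(has_signature_frame (phi := @component _ _ _ e x) (hG x ex)).
move=> [P [N PN]] rsm.
have Gcont : {for e x, continuous G} by apply: (Gsm 0%N); exists x.
have near_frame := cvg_comp _ _ (chart_map_continuous ex) Gcont _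
  (signature_locally_constant PN rsm).
near=> y => r' s'.
have ey : chart_dom e y.
  by near: y; apply: open_nbhs_nbhs; split=> //; exact: chart_dom_open.
move=> /(has_signature_frame (phi := @component _ _ _ e y) (hG y ey)).
move=> [P' [N' PN']].
move: r' s' P' N' PN'; near: y.
exact: near_frame.
Unshelve. all: by end_near. Qed.

End Born.

Lemma locally_constant_component (T : topologicalType) (A : Type) (f : T -> A)
    x0 x :
  (forall y, \forall z \near y, f z = f y) ->
  connected_component [set: T] x0 x -> f x = f x0.
Proof.
move=> f_loc [C [Cx0 _ Cconn] Cx].
pose B := C `&` [set y | f y = f x0].
suff -> : [set y | f y = f x0] x by [].
suff BC : B = C by move: Cx; rewrite -BC => -[].
apply: Cconn; first by exists x0.
  exists [set y | f y = f x0] => //; rewrite openE => y /= fy.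
  by near=> z; rewrite /= -fy; near: z; exact: f_loc.
exists [set y | f y = f x0] => //; rewrite -openC openE => y /= fy.
by near=> z; rewrite /= (near (f_loc y) z).
Unshelve. all: by end_near. Qed.

Theorem proposition16 (R : realType) (n : nat) (M : smooth_manifold R (2 * n))
    (g h w : bilinear_field M) (ghw : born_structure g h w) (x0 : M) :
  exists p q : nat, (p + q = n)%N /\
    forall x : M, connected_component [set: M] x0 x ->
      has_signature (h x) (2 * p) (2 * q).
Proof.
have /choice[p pP] (y : M) : exists p, (p <= n)%N /\
    has_signature (h y) (2 * p) (2 * (n - p)).
  have [p [q [pqn hy]]] := born_signature ghw y.
  have npq : (n - p = q)%N by lia.
  by exists p; rewrite npq; split=> //; lia.
exists (p x0), (n - p x0)%N; split=> [|x x0x]; first by have [] := pP x0; lia.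
rewrite -(locally_constant_component (f := p) _ x0x); first by have [] := pP x.
move=> y; have [py hy] := pP y.
have yn : (2 * p y + 2 * (n - p y) = 2 * n)%N by lia.
apply: filterS (near_signature ghw hy yn) => z y_near_z.
have [pz hz] := pP z; have zn : (2 * p z + 2 * (n - p z) = 2 * n)%N by lia.
by have := y_near_z _ _ hz zn; lia.
Qed.
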